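(* Let $1\le d\le 2$ be a fixed rational number. Then for every $\varepsilon>0$ there exists an integer $n_0=n_0(d,\varepsilon)$ such that every graph $G$ of average degree $d$ on $n\ge n_0$ vertices satisfies \[ \frac{\lambda_2(G)}{\lambda_n(G)}\le\frac{d-2\sqrt{d-1}}{d+2\sqrt{d-1}}+\varepsilon. \] In particular, if $G$ is a graph on $n\ge 6$ vertices of average degree $2$, then $\frac{\lambda_2(G)}{\lambda_n(G)}\le\frac{9}{4n}$.
   Context: All graphs are finite and simple. For a graph $G$ on $n$ vertices, $L_G=D_G-A_G$ is its Laplacian matrix ($D_G$ the diagonal degree matrix, $A_G$ the adjacency matrix), with eigenvalues $0=\lambda_1(G)\le\lambda_2(G)\le\cdots\le\lambda_n(G)$. The average degree of $G$ is $2|E(G)|/|V(G)|$. *)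

(* Defs.v *)
From mathcomp Require Import all_boot all_order all_algebra.
From mathcomp Require Import polyrcf.
From mathcomp Require Import reals.

Set Implicit Arguments.
Unset Strict Implicit.
Unset Printing Implicit Defensive.

Import Order.TTheory GRing.Theory Num.Theory.
Local Open Scope ring_scope.

Record sgraph (V : finType) := SGraph {
  adj : rel V;
  adj_sym : symmetric adj;
  adj_irr : irreflexive adj
}.

Definition edges (V : finType) (G : sgraph V) : {set {set V}} :=
  [set [set p.1; p.2] | p : V * V & adj G p.1 p.2].

Definition degree (V : finType) (G : sgraph V) (v : V) : nat :=
  #|[set w | adj G v w]|.

Definition average_degree (V : finType) (G : sgraph V) : rat :=
  (2 * #|edges G|)%:R / #|V|%:R.

(* Rows and columns are indexed by the vertices through [enum_val]. *)
Definition adj_mx (R : realType) (V : finType) (G : sgraph V) : 'M[R]_#|V| :=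
  \matrix_(i, j) (adj G (enum_val i) (enum_val j))%:R.

Definition deg_mx (R : realType) (V : finType) (G : sgraph V) : 'M[R]_#|V| :=
  diag_mx (\row_i (degree G (enum_val i))%:R).

Definition laplacian (R : realType) (V : finType) (G : sgraph V)
  : 'M[R]_#|V| := deg_mx R G - adj_mx R G.

(* [rootsR] lists the distinct real roots in increasing order; each one is
   repeated according to its algebraic multiplicity.  For a symmetric matrix,
   all of whose eigenvalues are real, the result has length n. *)
Definition spectrum (R : realType) (n : nat) (A : 'M[R]_n) : seq R :=
  flatten [seq nseq (mup x (char_poly A)) x | x <- rootsR (char_poly A)].

(* [lambda R G k] is the k-th smallest Laplacian eigenvalue, counting from
   k = 1, so that lambda_n is [lambda R G #|V|]. *)
Definition lambda (R : realType) (V : finType) (G : sgraph V) (k : nat) : R :=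
  nth 0 (spectrum (laplacian R G)) k.-1.

(* Main.v *)
Require Import Defs.
From mathcomp Require Import all_boot all_order all_algebra.
From mathcomp Require Import sesquilinear spectral complex polyrcf.
From mathcomp Require Import reals ring lra zify.

(* If G is disconnected then lambda_2 <= 0; for d < 2 every large G is
   disconnected, having fewer than n - 1 edges.  Let d = 2 and G be connected,
   so that |E| = n, and let D be the maximum degree.  The star at a vertex of
   degree D gives lambda_n >= D + 1, and lambda_2 is bounded by test vectors
   constant on two vertex sets A, B and 0 elsewhere.

   If D = 2, growing a set one vertex at a time keeps at most two edges leaving
   it; take A to be such a set with about n/2 vertices, and B the vertices
   neither in A nor adjacent to A.  If D >= 3, then either at most two edges
   leave some A with n/3 <= |A| <= 2n/3, or there is a vertex v such that the
   components of G - v split into two groups of between (n-1)/3 and 2(n-1)/3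
   vertices; at most D edges join v to the two groups, hence at most D/2 to one
   of them.  The dichotomy is found by taking a smallest connected set S with
   connected complement and |S| >= n/3: the edge count leaves at most two edges
   between S and its complement. *)

Set Implicit Arguments.
Unset Strict Implicit.
Unset Printing Implicit Defensive.

Import Order.TTheory GRing.Theory Num.Theory.
Local Open Scope ring_scope.

Lemma root_mem_rootsR {R : rcfType} (p : {poly R}) (x : R) :
  p != 0 -> (x \in rootsR p) = root p x.
Proof. by move=> /roots_on_rootsR /(_ x). Qed.

Lemma sorted_flatten_nseq {R : realDomainType} (m : R -> nat) (s : seq R) :
  sorted <%R s -> sorted <=%R (flatten [seq nseq (m x) x | x <- s]).
Proof.
rewrite lt_sorted_pairwise sorted_pairwise; last exact: le_trans.
elim: s => //= x s IHs /andP[xs /IHs IH].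
rewrite pairwise_cat IH andbT; apply/andP; split.
  apply/allrelP => y z; rewrite mem_nseq => /andP[_ /eqP ->].
  case/flattenP => t /mapP[w ws ->]; rewrite mem_nseq => /andP[_ /eqP ->].
  by move/allP: xs => /(_ _ ws)/ltW.
by elim: (m x) => //= k ->; rewrite all_nseq /= lexx orbT.
Qed.

Lemma count_flatten_nseq {T : eqType} (m : T -> nat) (s : seq T) (y : T) :
  uniq s -> count_mem y (flatten [seq nseq (m x) x | x <- s]) =
  (if y \in s then m y else 0)%N.
Proof.
elim: s => //= x s IHs /andP[xs us]; rewrite count_cat IHs // count_nseq /=.
rewrite inE eq_sym; case: (eqVneq x y) => [<-|nxy] /=.
  by rewrite (negPf xs) mul1n addn0.
by rewrite mul0n.
Qed.

Lemma spectrum_sort {R : realType} {n : nat} (A : 'M[R]_n) (s : seq R) :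
  char_poly A = \prod_(x <- s) ('X - x%:P) -> spectrum A = sort <=%R s.
Proof.
move=> eA; have p0 : char_poly A != 0 by rewrite monic_neq0 ?char_poly_monic.
apply: (@sorted_eq _ <=%R).
- exact: le_trans.
- exact: le_anti.
- by apply: sorted_flatten_nseq; exact: sorted_roots.
- by apply: sort_sorted; exact: le_total.
rewrite (perm_trans (y := s)) // ?perm_sort //; last by rewrite perm_sym perm_sort.
apply/allP => x _ /=; apply/eqP; rewrite count_flatten_nseq ?uniq_roots //.
rewrite root_mem_rootsR // eA mu_prod_XsubC; case: ifP => // /negbT.
by rewrite root_prod_XsubC => /count_memPn.
Qed.

Lemma char_poly_conj {F : fieldType} {n : nat} (P D : 'M[F]_n) :
  P \in unitmx -> char_poly (invmx P *m D *m P) = char_poly D.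
Proof.
move=> uP; pose p := @polyC F.
have e : char_poly_mx (invmx P *m D *m P) =
  map_mx p (invmx P) *m char_poly_mx D *m map_mx p P.
  rewrite /char_poly_mx mulmxBr mulmxBl -!map_mxM; congr (_ - _).
  by rewrite mul_mx_scalar -scalemxAl -map_mxM mulVmx // map_mx1 scalemx1.
rewrite /char_poly e !det_mulmx mulrAC -det_mulmx -map_mxM mulVmx //.
by rewrite map_mx1 det1 mul1r.
Qed.

Lemma sort_nth1_le_others {R : realType} {n : nat} (r : 'I_n -> R) : (1 < n)%N ->
  exists i0, forall i, i != i0 ->
    nth 0 (sort <=%R [seq r i | i <- enum 'I_n]) 1 <= r i.
Proof.
move=> n1; set s := sort _ _.
have ps : perm_eq s [seq r i | i <- enum 'I_n] by rewrite perm_sort.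
have ss : sorted <=%R s by apply: sort_sorted; exact: le_total.
have : size s = n by rewrite (perm_size ps) size_map size_enum_ord.
case: s ps ss => [|x [|y s]] ps ss; try by move=> /= e; rewrite -e in n1.
move=> _; have : x \in [seq r i | i <- enum 'I_n] by rewrite -(perm_mem ps) inE eqxx.
case/mapP => i0 i0E xE; exists i0 => i ni.
have := perm_to_rem i0E => /(perm_map r) /(perm_trans ps) /=.
rewrite xE perm_cons => /perm_mem /(_ (r i)).
rewrite map_f; last by rewrite mem_rem_uniq ?enum_uniq // !inE ni mem_enum.
rewrite inE => /orP[/eqP -> //|ris].
move: ss; rewrite sorted_pairwise; last exact: le_trans.
by case/andP => _ /= /andP[/allP /(_ _ ris)].
Qed.

Lemma le_last_sort {R : realType} {n : nat} (r : 'I_n -> R) (i : 'I_n) :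
  r i <= nth 0 (sort <=%R [seq r i | i <- enum 'I_n]) n.-1.
Proof.
set s := sort _ _.
have ps : perm_eq s [seq r i | i <- enum 'I_n] by rewrite perm_sort.
have ss : sorted <=%R s by apply: sort_sorted; exact: le_total.
have sz : size s = n by rewrite (perm_size ps) size_map size_enum_ord.
have ris : r i \in s by rewrite (perm_mem ps) map_f // mem_enum.
rewrite -{1}(nth_index 0 ris).
have n0 : (0 < n)%N by case: (n) i {ris ps sz} => [[]|].
apply: (sorted_leq_nth le_trans le_refl _ ss); rewrite ?inE ?index_mem // ?sz.
  by rewrite ltn_predL.
by rewrite -ltnS (prednK n0) -sz index_mem.
Qed.

Section SymmetricMatrix.

Local Open Scope sesquilinear_scope.

Variables (R : realType) (n : nat) (A : 'M[R]_n).
Hypothesis symA : A^T = A.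

Local Notation C := (complex R).
Local Notation toC := (real_complex R).
Local Notation eig := (fun i => complex.Re (spectral_diag (map_mx toC A) 0 i)).
Local Notation coord z := (z *m (spectralmx (map_mx toC A))^t*).

Lemma conjC_real_complex (x : R) : (toC x)^* = toC x.
Proof. exact: conjc_real. Qed.

Lemma map_mx_hermsym : map_mx toC A \is hermsymmx.
Proof.
apply: realsym_hermsym; last first.
  by apply/mxOverP => i j; rewrite mxE; apply/complex_realP; exists (A i j).
apply/is_hermitianmxP; rewrite expr0 scale1r map_mx_id //.
by rewrite map_trmx symA.
Qed.

Lemma spectral_decomposition :
  map_mx toC A = (spectralmx (map_mx toC A))^t* *m diag_mx (\row_i toC (eig i))
    *m spectralmx (map_mx toC A).
Proof.
have h := map_mx_hermsym.
have /orthomx_spectralP {1}-> := hermitian_normalmx h.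
rewrite invmx_unitary ?spectral_unitarymx //; congr (_ *m diag_mx _ *m _).
apply/rowP => i; rewrite mxE RRe_real //.
exact: (mxOverP (hermitian_spectral_diag_real h)).
Qed.

Lemma char_poly_eig :
  char_poly A = \prod_(x <- [seq eig i | i <- enum 'I_n]) ('X - x%:P).
Proof.
apply: (@map_poly_inj _ _ toC).
have -> : map_poly toC (char_poly A) = char_poly (map_mx toC A).
  exact: map_char_poly.
rewrite [in LHS]spectral_decomposition -invmx_unitary ?spectral_unitarymx //.
rewrite char_poly_conj ?spectral_unit // char_poly_trig ?diag_mx_is_trig //.
rewrite big_map rmorph_prod /= big_enum /=; apply: eq_bigr => i _.
by rewrite map_polyXsubC !mxE eqxx mulr1n.
Qed.

Lemma form_coord (z : 'rV[C]_n) :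
  (z *m map_mx toC A *m z^t*) 0 0 = \sum_i toC (eig i) * `|coord z 0 i| ^+ 2.
Proof.
rewrite {1}spectral_decomposition !mulmxA.
set c := coord z; rewrite -mulmxA.
have -> : spectralmx (map_mx toC A) *m z^t* = c^t*.
  by rewrite /c trmx_mul map_mxM trmxCK.
rewrite mul_mx_diag mxE; apply: eq_bigr => i _.
by rewrite !mxE mulrAC normCK [RHS]mulrC.
Qed.

Lemma dot_coord (z : 'rV[C]_n) : (z *m z^t*) 0 0 = \sum_i `|coord z 0 i| ^+ 2.
Proof.
have -> : z *m z^t* = coord z *m (coord z)^t*.
  rewrite trmx_mul map_mxM trmxCK mulmxA mulmxKtV //.
  exact: spectral_unitarymx.
by rewrite mxE; apply: eq_bigr => i _; rewrite !mxE normCK.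
Qed.

Lemma spectrum_eig :
  spectrum A = sort <=%R [seq eig i | i <- enum 'I_n].
Proof. exact/spectrum_sort/char_poly_eig. Qed.

Lemma map_mx_toC_conj (x : 'rV[R]_n) : (map_mx toC x)^t* = map_mx toC x^T.
Proof. by apply/matrixP => i j; rewrite !mxE conjC_real_complex. Qed.

Lemma rayleigh_le_max (x : 'rV[R]_n) :
  (x *m A *m x^T) 0 0 <= nth 0 (spectrum A) n.-1 * (x *m x^T) 0 0.
Proof.
rewrite -lecR rmorphM /=.
have E (B : 'M[R]_1) : toC (B 0 0) = (map_mx toC B) 0 0 by rewrite mxE.
rewrite !E !map_mxM -!map_mx_toC_conj form_coord dot_coord mulr_sumr.
apply: ler_sum => i _; rewrite ler_wpM2r ?exprn_ge0 ?normr_ge0 // lecR.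
by rewrite spectrum_eig (le_last_sort (fun i => eig i)).
Qed.

Lemma second_le_form (c : 'I_n -> C) i0 (l : R) :
  (forall i, i != i0 -> l <= eig i) -> c i0 = 0 ->
  toC l * \sum_i `|c i| ^+ 2 <= \sum_i toC (eig i) * `|c i| ^+ 2.
Proof.
move=> hl c0; rewrite mulr_sumr; apply: ler_sum => i _.
case: (eqVneq i i0) => [->|/hl h]; first by rewrite c0 normr0 expr0n /= !mulr0.
by rewrite ler_wpM2r ?exprn_ge0 ?normr_ge0 // lecR.
Qed.

(* Courant--Fischer on the plane spanned by [u] and [x]: it contains a nonzero
   vector whose coordinate along the lowest eigenvector vanishes. *)
Lemma second_le_rayleigh (u x : 'rV[R]_n) : (1 < n)%N ->
  u *m A = 0 -> 0 < (u *m u^T) 0 0 -> u *m x^T = 0 ->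
  0 <= (x *m A *m x^T) 0 0 -> 0 <= (x *m x^T) 0 0 ->
  nth 0 (spectrum A) 1 * (x *m x^T) 0 0 <= (x *m A *m x^T) 0 0.
Proof.
move=> n1 uA uu ux xAx xx; rewrite spectrum_eig.
have [i0 hi0] := sort_nth1_le_others (fun i => eig i) n1.
set l := nth _ _ _ in hi0 *.
have [l0|l0] := lerP l 0; first by apply: le_trans xAx; exact: mulr_le0_ge0.
have xu : x *m u^T = 0 by rewrite -[LHS]trmxK trmx_mul trmxK ux trmx0.
have Au : A *m u^T = 0 by rewrite -[LHS]trmxK trmx_mul trmxK symA uA trmx0.
pose X := map_mx toC x; pose U := map_mx toC u.
have comb (a b : C) : coord (a *: U + b *: X) 0 i0 = 0 ->
    toC l * (`|a| ^+ 2 * toC ((u *m u^T) 0 0) + `|b| ^+ 2 * toC ((x *m x^T) 0 0))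
      <= `|b| ^+ 2 * toC ((x *m A *m x^T) 0 0).
  move=> c0.
  have := second_le_form hi0 c0.
  rewrite -form_coord -dot_coord.
  have zt : (a *: U + b *: X)^t* = a^* *: map_mx toC u^T + b^* *: map_mx toC x^T.
    by apply/matrixP => i j; rewrite !mxE rmorphD !rmorphM /= !conjC_real_complex.
  rewrite zt !mulmxDl !mulmxDr -!scalemxAl -!scalemxAr -!map_mxM.
  rewrite uA ux xu !mul0mx -!mulmxA Au !mulmx0 !map_mx0 !scaler0 !addr0 !add0r.
  by rewrite !normCK !mxE -!mulrA.
have [cu0|cu0] := eqVneq (coord U 0 i0) 0.
  have /comb : coord (1 *: U + 0 *: X) 0 i0 = 0 by rewrite scale1r scale0r addr0.
  rewrite normr1 normr0 !expr0n !expr1n /= !mul0r mul1r addr0 -rmorphM lecR.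
  by rewrite leNgt mulr_gt0.
have /comb : coord (- coord X 0 i0 *: U + coord U 0 i0 *: X) 0 i0 = 0.
  rewrite mulmxDl -!scalemxAl; move: (coord U) (coord X) => cU cX; rewrite !mxE.
  by rewrite mulNr mulrC addNr.
set a := - _; set b := coord U 0 i0 => h.
have b2 : 0 < `|b| ^+ 2 by rewrite exprn_gt0 // normr_gt0.
rewrite -lecR rmorphM /= -(ler_pM2l b2); apply: le_trans h.
rewrite mulrCA ler_wpM2l //; first by rewrite ler0c ltW.
by rewrite lerDr mulr_ge0 ?exprn_ge0 ?normr_ge0 // ler0c ltW.
Qed.

End SymmetricMatrix.

Section LaplacianForm.

Variables (R : realType) (V : finType) (G : sgraph V).

Definition edges_between (A B : {set V}) : nat :=
  \sum_(v in A) \sum_(w in B) adj G v w.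

Definition vec_of (f : V -> R) : 'rV[R]_#|V| := \row_i f (enum_val i).

Definition energy (f : V -> R) : R :=
  \sum_v \sum_w (adj G v w)%:R * (f v - f w) ^+ 2.

Lemma sum_enum_val (F : V -> R) : \sum_(i < #|V|) F (enum_val i) = \sum_v F v.
Proof. by rewrite [RHS](big_enum_val (A := V)). Qed.

Lemma dot_vec_of (f g : V -> R) :
  (vec_of f *m (vec_of g)^T) 0 0 = \sum_v f v * g v.
Proof. by rewrite mxE -sum_enum_val; apply: eq_bigr => i _; rewrite !mxE. Qed.

Lemma degree_sum (v : V) : (degree G v)%:R = \sum_w (adj G v w)%:R :> R.
Proof.
rewrite /degree -sum1_card natr_sum big_mkcond /=; apply: eq_bigr => w _.
by rewrite inE; case: adj.
Qed.

Lemma laplacian_sym : (laplacian R G)^T = laplacian R G.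
Proof.
apply/matrixP => i j; rewrite !mxE adj_sym.
by case: (eqVneq i j) => [->|]; rewrite ?eqxx // => /negPf; rewrite eq_sym => ->.
Qed.

Lemma mul_laplacian (f : V -> R) :
  vec_of f *m laplacian R G =
  vec_of (fun v => \sum_w (adj G v w)%:R * (f v - f w)).
Proof.
apply/rowP => i; rewrite mulmxBr !mxE.
under [X in _ - X]eq_bigr => j _ do rewrite !mxE.
rewrite (sum_enum_val (fun w => f w * (adj G w (enum_val i))%:R)).
rewrite (bigD1 i) //= !mxE eqxx mulr1n big1 ?addr0; last first.
  by move=> j ji; rewrite !mxE (negPf ji) mulr0.
rewrite degree_sum mulr_sumr -sumrB; apply: eq_bigr => w _.
by rewrite adj_sym; ring.
Qed.

Lemma laplacian_form (f : V -> R) :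
  2 * (vec_of f *m laplacian R G *m (vec_of f)^T) 0 0 = energy f.
Proof.
rewrite mul_laplacian dot_vec_of mulr_natl mulr2n.
have e1 : \sum_v (\sum_w (adj G v w)%:R * (f v - f w)) * f v =
    \sum_v \sum_w (adj G v w)%:R * (f v - f w) * f v.
  by apply: eq_bigr => v _; rewrite mulr_suml.
rewrite {1}e1 e1 [X in _ + X]exchange_big -big_split; apply: eq_bigr => v _ /=.
rewrite -big_split; apply: eq_bigr => w _ /=.
by rewrite (adj_sym G w v); ring.
Qed.

Lemma energy_ge0 (f : V -> R) : 0 <= energy f.
Proof.
by do 2![apply: sumr_ge0 => ? _]; rewrite mulr_ge0 ?sqr_ge0.
Qed.

Lemma energy_le_lambdan (f : V -> R) :
  energy f <= 2 * (lambda R G #|V| * \sum_v f v ^+ 2).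
Proof.
rewrite -laplacian_form ler_pM2l //.
have := rayleigh_le_max laplacian_sym (vec_of f).
by rewrite dot_vec_of.
Qed.

Lemma lambda2_le_energy (f : V -> R) : (1 < #|V|)%N -> \sum_v f v = 0 ->
  2 * (lambda R G 2 * \sum_v f v ^+ 2) <= energy f.
Proof.
move=> n1 f0; rewrite -laplacian_form ler_pM2l //.
pose one : V -> R := fun=> 1.
have := second_le_rayleigh (u := vec_of one) (x := vec_of f) laplacian_sym n1.
rewrite !dot_vec_of; apply.
- rewrite mul_laplacian; apply/rowP => i; rewrite !mxE.
  by rewrite big1 // => w _; rewrite subrr mulr0.
- rewrite (eq_bigr (fun=> 1)) ?sumr_const; last by move=> v _; rewrite mulr1.
  by rewrite ltr0n; exact: ltnW.
- apply/matrixP => i j; rewrite !ord1 dot_vec_of mxE -[RHS]f0.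
  by apply: eq_bigr => v _; rewrite mul1r.
- by rewrite -(pmulr_rge0 _ (ltr0n _ 2)) laplacian_form energy_ge0.
- by apply: sumr_ge0 => v _; rewrite -expr2 sqr_ge0.
Qed.

Lemma lambdan_ge0 : (0 < #|V|)%N -> 0 <= lambda R G #|V|.
Proof.
move=> n0; have := energy_le_lambdan (fun=> 1).
move/(le_trans (energy_ge0 _)); rewrite pmulr_rge0 //.
by rewrite pmulr_lge0 // expr1n sumr_const ltr0n.
Qed.

Lemma edges_between_sum (A B : {set V}) : (edges_between A B)%:R =
  \sum_v \sum_w (adj G v w)%:R * ((v \in A)%:R * (w \in B)%:R) :> R.
Proof.
rewrite /edges_between natr_sum big_mkcond /=; apply: eq_bigr => v _.
case: (v \in A); last by rewrite big1 // => w _; rewrite mul0r mulr0.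
rewrite natr_sum big_mkcond /=; apply: eq_bigr => w _.
by case: (w \in B); rewrite ?mulr1 ?mulr0 ?mul1r.
Qed.

Lemma edges_betweenC (A B : {set V}) : edges_between A B = edges_between B A.
Proof.
rewrite /edges_between exchange_big; apply: eq_bigr => v _; apply: eq_bigr => w _.
by rewrite adj_sym.
Qed.

Definition two_valued (A B : {set V}) (a b : R) (v : V) : R :=
  a * (v \in A)%:R + b * (v \in B)%:R.

Lemma sum_two_valued (A B : {set V}) (a b : R) :
  \sum_v two_valued A B a b v = a * #|A|%:R + b * #|B|%:R.
Proof.
have c (S : {set V}) : #|S|%:R = \sum_v (v \in S)%:R :> R.
  by rewrite -sum1_card natr_sum big_mkcond; apply: eq_bigr => v _; case: (v \in S).
by rewrite big_split /= -!mulr_sumr -!c.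
Qed.

Lemma sum_sqr_two_valued (A B : {set V}) (a b : R) : [disjoint A & B] ->
  \sum_v two_valued A B a b v ^+ 2 = a ^+ 2 * #|A|%:R + b ^+ 2 * #|B|%:R.
Proof.
move=> dAB; rewrite -sum_two_valued; apply: eq_bigr => v _; rewrite /two_valued.
case: (boolP (v \in A)) => [/(disjointFr dAB) ->|_]; first by rewrite /=; ring.
by case: (v \in B); rewrite /=; ring.
Qed.

Lemma energy_two_valued (A B : {set V}) (a b : R) : [disjoint A & B] ->
  energy (two_valued A B a b) = 2 *
    ((a - b) ^+ 2 * (edges_between A B)%:R +
     a ^+ 2 * (edges_between A (~: (A :|: B)))%:R +
     b ^+ 2 * (edges_between B (~: (A :|: B)))%:R).
Proof.
move=> dAB; rewrite mulr_natl mulr2n.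
rewrite {2}(edges_betweenC A B) {2}(edges_betweenC A (~: _)).
rewrite {2}(edges_betweenC B (~: _)) !edges_between_sum !mulr_sumr -!big_split.
apply: eq_bigr => v _ /=; rewrite !mulr_sumr -!big_split.
apply: eq_bigr => w _ /=; rewrite /two_valued !inE.
have dis u : (u \in A) && (u \in B) = false.
  by case: (boolP (u \in A)) => // /(disjointFr dAB) ->.
move: (dis v) (dis w); move: (_%:R) => e.
by case: (v \in A); case: (v \in B) => //= _; case: (w \in A);
  case: (w \in B) => //= _; ring.
Qed.

Lemma lambda2_two_sets (A B : {set V}) : (1 < #|V|)%N -> [disjoint A & B] ->
  lambda R G 2 * (#|A|%:R * #|B|%:R * (#|A| + #|B|)%:R) <=
    (#|A| + #|B|)%:R ^+ 2 * (edges_between A B)%:R +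
    #|B|%:R ^+ 2 * (edges_between A (~: (A :|: B)))%:R +
    #|A|%:R ^+ 2 * (edges_between B (~: (A :|: B)))%:R.
Proof.
move=> n1 dAB.
have := @lambda2_le_energy (two_valued A B #|B|%:R (- #|A|%:R)) n1.
rewrite sum_two_valued mulNr mulrC subrr => /(_ erefl).
rewrite energy_two_valued // sum_sqr_two_valued // ler_pM2l // opprK sqrrN.
rewrite (addrC #|B|%:R #|A|%:R) natrD.
rewrite (_ : #|B|%:R ^+ 2 * _ + _ = #|A|%:R * #|B|%:R * (#|A|%:R + #|B|%:R)) //.
by ring.
Qed.

Lemma lambda2_cut (A : {set V}) : (1 < #|V|)%N ->
  lambda R G 2 * (#|A|%:R * #|~: A|%:R) <= #|V|%:R * (edges_between A (~: A))%:R.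
Proof.
move=> n1; have := lambda2_two_sets (A := A) (B := ~: A) n1.
rewrite cardsC setUCr setCT -setI_eq0 setICr eqxx => /(_ isT).
have e0 S : edges_between S set0 = 0%N.
  by rewrite /edges_between big1 // => v _; rewrite big_set0.
rewrite !e0 !mulr0 !addr0 mulrA (mulrC _ #|V|%:R) expr2 -[leRHS]mulrA ler_pM2l //.
by rewrite ltr0n; exact: ltnW.
Qed.

Lemma edges_between_set1 (v : V) (B : {set V}) :
  [set w | adj G v w] \subset B -> edges_between [set v] B = degree G v.
Proof.
move=> /subsetP sB; rewrite /edges_between big_set1 /degree -sum1_card.
rewrite [RHS]big_mkcond [LHS]big_mkcond; apply: eq_bigr => w _ /=.
have := sB w; rewrite !inE; case: (adj G v w); last by case: ifP.
by move=> ->.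
Qed.

Lemma degree_lt_lambdan (v : V) : (0 < degree G v)%N ->
  (degree G v).+1%:R <= lambda R G #|V|.
Proof.
move=> d0; set N := [set w | adj G v w].
have dis : [disjoint [set v] & N] by rewrite disjoints1 inE adj_irr.
have := energy_le_lambdan (two_valued [set v] N (degree G v)%:R (-1)).
rewrite energy_two_valued // sum_sqr_two_valued // ler_pM2l // cards1.
rewrite edges_between_set1 // -/(degree G v) sqrrN expr1n mulr1 mul1r opprK.
move: (edges_between _ _) (edges_between _ _) (degree G v) d0 => p q d d0 h.
have {h} : (d%:R + 1) ^+ 2 * d%:R <= lambda R G #|V| * (d%:R ^+ 2 + d%:R).
  rewrite mul1r in h; apply: le_trans h; rewrite -addrA lerDl.
  by rewrite addr_ge0 ?mulr_ge0 ?sqr_ge0.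
have dd : 0 < d%:R :> R by rewrite ltr0n.
rewrite (_ : _ * d%:R = (d%:R + 1) * (d%:R ^+ 2 + d%:R)); last by ring.
by rewrite ler_pM2r -?natr1 // addr_gt0 // exprn_gt0.
Qed.

End LaplacianForm.

Section EdgeCounts.

Variables (V : finType) (G : sgraph V).
Implicit Types (A B C S T W : {set V}) (v w x y : V).

Local Notation e := (edges_between G).

Lemma edges_between_gt0 A B x y :
  x \in A -> y \in B -> adj G x y -> (0 < e A B)%N.
Proof.
by move=> xA yB xy; rewrite /edges_between (bigD1 x) //= (bigD1 y) //= xy.
Qed.

Lemma edges_between_eq0 A B :
  {in A & B, forall x y, ~~ adj G x y} -> e A B = 0%N.
Proof.
move=> h; rewrite /edges_between big1 // => x xA; rewrite big1 // => y yB.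
by rewrite (negPf (h _ _ xA yB)).
Qed.

Lemma edges_betweenUr A B C : [disjoint B & C] -> e A (B :|: C) = (e A B + e A C)%N.
Proof.
move=> dBC; rewrite /edges_between -big_split; apply: eq_bigr => x _ /=.
by rewrite -bigU //; apply: eq_bigl => y; rewrite inE.
Qed.

Lemma edges_betweenUl A B C : [disjoint A & B] -> e (A :|: B) C = (e A C + e B C)%N.
Proof. by move=> dAB; rewrite edges_betweenC edges_betweenUr // !(edges_betweenC _ C). Qed.

Lemma edges_betweenSr A B C : B \subset C -> (e A B <= e A C)%N.
Proof.
move=> sBC; rewrite -(setID C B) (setIidPr sBC) edges_betweenUr ?leq_addr //.
by apply/pred0P => x; rewrite /= inE; case: (x \in B).
Qed.

Lemma edges_betweenSl A B C : A \subset B -> (e A C <= e B C)%N.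
Proof. by move=> sAB; rewrite !(edges_betweenC _ _ C) edges_betweenSr. Qed.

Lemma card_edges : (2 * #|edges G|)%N = e setT setT.
Proof.
rewrite /edges; set D := [set p : V * V | adj G p.1 p.2].
have -> : [set [set p.1; p.2] | p : V * V & adj G p.1 p.2] =
    [set [set p.1; p.2] | p in D].
  by apply/setP => s; apply/imsetP/imsetP => -[p]; rewrite ?inE => h ->;
    exists p; rewrite ?inE.
set f := fun p : V * V => _.
have <- : #|D| = e setT setT.
  rewrite -sum1_card /edges_between.
  rewrite (eq_bigl (fun p : V * V => true && adj G p.1 p.2)); last by move=> p; rewrite inE.
  rewrite -(pair_big_dep xpredT (fun x y => adj G x y) (fun _ _ => 1%N)) /=.
  apply: eq_big => [x|x _]; first by rewrite inE.
  rewrite big_mkcond; apply: eq_big => [y|y _]; first by rewrite inE.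
  by case: adj.
rewrite -[in RHS]sum1_card (partition_big_imset f) /= mulnC -sum_nat_const.
apply: eq_bigr => s /imsetP[[a b] /=]; rewrite inE /= => ab ->.
rewrite sum1_card.
have nab : a != b by apply: contraTneq ab => ->; rewrite adj_irr.
have <- : #|[set (a, b); (b, a)]| = 2%N.
  by rewrite cards2; case: eqP => // -[] /eqP; rewrite (negPf nab).
apply: eq_card => -[c d]; rewrite !inE /f /= !xpair_eqE.
apply/orP/andP => [[]/andP[/eqP-> /eqP->]|[cd /eqP/setP h]].
- by rewrite inE /= ab.
- by rewrite inE /= adj_sym ab setUC.
have ncd : c != d.
  by apply: contraTneq cd => ->; rewrite inE /= adj_irr.
have := h c; have := h d; rewrite !inE !eqxx orbT /= => /esym hd /esym hc.
case/orP: hc => /eqP hc; case/orP: hd => /eqP hd; rewrite hc hd ?eqxx in ncd *;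
  by [left | right | case/eqP: ncd].
Qed.

Lemma sum_degree : (\sum_v degree G v = e setT setT)%N.
Proof.
rewrite /edges_between; apply: eq_big => [v|v _]; first by rewrite inE.
rewrite /degree -sum1_card big_mkcond; apply: eq_big => [w|w _]; rewrite inE //.
Qed.

End EdgeCounts.

Section Connectivity.

Variables (V : finType) (G : sgraph V).
Implicit Types (A B C S T W : {set V}) (v w x y : V).

Local Notation e := (edges_between G).

Definition closed_in W C : bool := (C \subset W) &&
  [forall x in C, forall y in W, adj G x y ==> (y \in C)].

Definition connected S : bool :=
  [forall T : {set V}, closed_in S T && (T != set0) ==> (T == S)].

Lemma closed_inP W C : reflect
  (C \subset W /\ forall x y, x \in C -> y \in W -> adj G x y -> y \in C)
  (closed_in W C).
Proof.
apply: (iffP andP) => -[sCW h]; split=> //.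
  by move=> x y xC yW; move: (forall_inP h _ xC) => /forall_inP/(_ _ yW)/implyP.
by apply/forall_inP => x xC; apply/forall_inP => y yW; apply/implyP; exact: h.
Qed.

Lemma connectedP S : reflect
  (forall T, closed_in S T -> T != set0 -> T = S) (connected S).
Proof.
apply: (iffP forallP) => h T.
  by move=> cT T0; apply/eqP; apply: (implyP (h T)); rewrite cT.
by apply/implyP => /andP[cT T0]; rewrite (h T).
Qed.

Lemma closed_in_edges W C : closed_in W C -> e C (W :\: C) = 0%N.
Proof.
case/closed_inP => _ h; apply: edges_between_eq0 => x y xC.
by rewrite inE => /andP[yC yW]; apply: contra yC; exact: h xC yW.
Qed.

Lemma closed_in_setC W C : closed_in W C -> closed_in W (W :\: C).
Proof.
case/closed_inP => _ h; apply/closed_inP; split; first exact: subsetDl.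
move=> x y; rewrite !inE => /andP[xC xW] yW xy; rewrite yW andbT.
by apply: contra xC => yC; apply: (h y x) => //; rewrite adj_sym.
Qed.

Lemma closed_in_trans W S T : closed_in S T -> closed_in W S -> closed_in W T.
Proof.
move=> /closed_inP[sTS hT] /closed_inP[sSW hS]; apply/closed_inP; split.
  exact: subset_trans sTS sSW.
move=> x y xT yW xy; apply: (hT x) => //; apply: (hS x) => //.
exact: (subsetP sTS).
Qed.

Lemma closed_inU W A B : closed_in W A -> closed_in W B -> closed_in W (A :|: B).
Proof.
move=> /closed_inP[sA hA] /closed_inP[sB hB]; apply/closed_inP; split.
  by rewrite subUset sA.
move=> x y; rewrite !inE => /orP[xA|xB] yW xy.
  by rewrite (hA x y).
by rewrite (hB x y) ?orbT.
Qed.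

Lemma closed_inI W A B : closed_in W A -> closed_in W B -> closed_in W (A :&: B).
Proof.
move=> /closed_inP[sA hA] /closed_inP[sB hB]; apply/closed_inP; split.
  exact: subset_trans (subsetIl _ _) sA.
by move=> x y; rewrite !inE => /andP[xA xB] yW xy; rewrite (hA x y) // (hB x y).
Qed.

Lemma closed_inD W A B : closed_in W A -> closed_in W B -> closed_in W (A :\: B).
Proof.
move=> cA cB; suff -> : A :\: B = A :&: (W :\: B).
  by apply: closed_inI cA _; exact: closed_in_setC.
have /closed_inP[/subsetP sA _] := cA.
apply/setP => x; rewrite !inE; case: (boolP (x \in A)) => [/sA ->|]; last by rewrite andbF.
by rewrite !andbT.
Qed.

Lemma closed_in_setI W S C : closed_in W C -> S \subset W -> closed_in S (C :&: S).
Proof.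
move=> /closed_inP[_ h] /subsetP sSW; apply/closed_inP; split; first exact: subsetIr.
by move=> x y; rewrite !inE => /andP[xC xS] yS xy; rewrite yS andbT (h x) // sSW.
Qed.

Lemma closed_in0 W : closed_in W set0.
Proof.
by apply/closed_inP; split; [exact: sub0set | move=> x y; rewrite inE].
Qed.

Lemma exists_connected_closed_in W K : closed_in W K -> K != set0 ->
  exists C, [/\ C \subset K, closed_in W C, C != set0 & connected C].
Proof.
move=> cK K0; pose P C := [&& C \subset K, closed_in W C & C != set0].
have PK : P K by rewrite /P subxx cK.
case: (arg_minnP (fun C : {set V} => #|C|) PK) => C /and3P[sCK cC C0] mC.
exists C; split=> //; apply/connectedP => T cT T0.
have /closed_inP[sTC _] := cT.
apply/eqP; rewrite eqEcard sTC mC // /P T0 (closed_in_trans cT cC) !andbT.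
exact: subset_trans sTC sCK.
Qed.

Lemma connected_grow S T : connected S -> T \subset S -> T != set0 -> T != S ->
  exists x y, [/\ x \in T, y \in S, y \notin T & adj G x y].
Proof.
move=> /connectedP cS sTS T0 TS.
case: (boolP (closed_in S T)) => [/cS/(_ T0)/eqP|]; first by rewrite (negPf TS).
rewrite /closed_in sTS /= => /forall_inPn[x xT /forall_inPn[y yS]].
by rewrite negb_imply => /andP[xy yT]; exists x, y.
Qed.

Lemma connected_edges S : connected S -> (2 * #|S|.-1 <= e S S)%N.
Proof.
move=> cS; have [->|[x0 x0S]] := set_0Vmem S; first by rewrite cards0.
have S0 : (0 < #|S|)%N by apply/card_gt0P; exists x0.
suff : forall k, (k < #|S|)%N -> exists T,
    [/\ T \subset S, #|T| = k.+1 & (2 * k <= e T T)%N].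
  case/(_ #|S|.-1); first by rewrite ltn_predL.
  move=> T [sT]; rewrite (prednK S0) => cT.
  by have -> : T = S by apply/eqP; rewrite eqEcard sT cT leqnn.
elim=> [|k IHk] kS; first by exists [set x0]; rewrite sub1set x0S cards1.
have [T [sT cT eT]] := IHk (ltnW kS).
have T0 : T != set0 by rewrite -card_gt0 cT.
have TS : T != S by apply: contraTneq kS => <-; rewrite cT ltnn.
have [x [y [xT yS yT xy]]] := connected_grow cS sT T0 TS.
have dT : [disjoint [set y] & T] by rewrite disjoints1.
exists (y |: T); split; first by rewrite subUset sub1set yS.
  by rewrite cardsU1 yT cT.
rewrite edges_betweenUl // !edges_betweenUr // (edges_betweenC G T [set y]).
rewrite (adj_sym G) in xy; have := edges_between_gt0 (set11 y) xT xy; lia.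
Qed.

Lemma edges_between_setTE S :
  e setT setT = (e S S + e (~: S) (~: S) + 2 * e S (~: S))%N.
Proof.
have d : [disjoint S & ~: S] by rewrite -setI_eq0 setICr.
by rewrite -(setUCr S) edges_betweenUl // !edges_betweenUr //
  (edges_betweenC G (~: S) S); lia.
Qed.

Lemma connected_cut_le2 S : connected S -> connected (~: S) ->
  e setT setT = (2 * #|V|)%N -> (e S (~: S) <= 2)%N.
Proof.
move=> /connected_edges hS /connected_edges hC; rewrite (edges_between_setTE S).
have := cardsC S; lia.
Qed.

(* [v] holds together the outside of [S] and the components of [S \ v] other
   than those in [C]. *)
Lemma connected_setC_component S v C : connected setT -> connected (~: S) ->
  v \in S -> (~: S = set0 \/ exists2 w, w \notin S & adj G v w) ->
  closed_in (S :\ v) C -> connected (~: C).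
Proof.
move=> cV cSc vS hv /closed_inP[/subsetP sC hC].
have vC : v \notin C by apply/negP => /sC; rewrite !inE eqxx.
have key T : closed_in (~: C) T -> v \in T -> T = ~: C.
  move=> /closed_inP[/subsetP sT hT] vT; apply/eqP; rewrite eqEsubset.
  apply/andP; split; first exact/subsetP.
  have sScT : ~: S \subset T.
    case: hv => [->|[w wS vw]]; first exact: sub0set.
    have wT : w \in T.
      apply: (hT v) => //; rewrite inE; apply: contra wS => /sC.
      by rewrite inE => /andP[].
    have /connectedP/(_ (T :&: ~: S)) := cSc.
    have -> : closed_in (~: S) (T :&: ~: S).
      apply: (@closed_in_setI (~: C)); first by apply/closed_inP; split=> //; apply/subsetP.
      by rewrite setCS; apply/subsetP => x /sC; rewrite inE => /andP[].
    have n0 : T :&: ~: S != set0 by apply/set0Pn; exists w; rewrite !inE wT.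
    by move=> /(_ isT n0) <-; exact: subsetIl.
  have /connectedP/(_ (~: T :\: C)) := cV.
  have cl : closed_in setT (~: T :\: C).
    apply/closed_inP; split; first exact: subsetT.
    move=> x y; rewrite !inE => /andP[xC xT] _ xy.
    have xS : x \in S :\ v.
      rewrite !inE; apply/andP; split; first by apply: contraNneq xT => ->.
      by apply: contraR xT => xS; apply: (subsetP sScT); rewrite inE.
    apply/andP; split.
      by apply: contra xC => yC; apply: (hC y) => //; rewrite adj_sym.
    by apply: contra xT => yT; apply: (hT y) => //; rewrite ?inE // adj_sym.
  move=> /(_ cl) h; apply/subsetP => x; rewrite inE => xC; apply/negPn/negP => xT.
  have : v \in ~: T :\: C.
    by rewrite h ?inE //; apply/set0Pn; exists x; rewrite !inE xC.
  by rewrite !inE vT andbF.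
apply/connectedP => T cT T0; have [vT|vT] := boolP (v \in T); first exact: key.
have := key _ (closed_in_setC cT); rewrite !inE vT vC => /(_ isT) h.
case/set0Pn: T0 => x xT; have /closed_inP[/subsetP/(_ _ xT) xC _] := cT.
by move: xC; rewrite -h inE xT.
Qed.

End Connectivity.

Section Separators.

Variables (V : finType) (G : sgraph V).
Implicit Types (A B C S T W : {set V}) (v w x y : V).

Local Notation e := (edges_between G).
Local Notation n := #|V|.

Hypothesis connV : connected G setT.
Hypothesis edgesV : e setT setT = (2 * #|V|)%N.

Lemma edges_between_three S v A B : v \in S ->
  A \subset S :\ v -> B \subset S :\ v -> [disjoint A & B] ->
  (e [set v] (~: S) + e A (~: S) + e B (~: S) <= e S (~: S))%N.
Proof.
move=> vS sA sB dAB.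
have dv : [disjoint [set v] & A :|: B].
  rewrite disjoints1 inE; apply/norP; split.
    by apply/negP => /(subsetP sA); rewrite !inE eqxx.
  by apply/negP => /(subsetP sB); rewrite !inE eqxx.
rewrite -addnA -edges_betweenUl // -edges_betweenUl // edges_betweenSl //.
rewrite !subUset sub1set vS /=; apply/andP; split.
  exact: subset_trans sA (subsetDl _ _).
exact: subset_trans sB (subsetDl _ _).
Qed.

(* Since [connected C] holds, [C] is a component of [G - v].  The outside of
   [S] is connected, and as at most one edge other than those at [v] leaves
   [S], it is glued to at most one component of [S - v]. *)
Lemma component_size S v C (m : nat) :
  connected G (~: S) -> (e S (~: S) <= 2)%N -> v \in S ->
  (~: S = set0 \/ exists2 w, w \notin S & adj G v w) ->
  (#|~: S| <= m)%N ->
  (forall K, closed_in G (S :\ v) K -> connected G K -> (#|K| <= m)%N) ->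
  closed_in G (~: [set v]) C -> connected G C -> (#|C| <= 2 * m)%N.
Proof.
move=> cSc cut2 vS hv cm hm cC connC.
have sSv : S :\ v \subset ~: [set v].
  by apply/subsetP => x; rewrite !inE => /andP[].
have [sC hC] := closed_inP _ _ _ cC.
have sScv : ~: S \subset ~: [set v].
  by rewrite setCS sub1set.
have [d0|dn0] := eqVneq (C :&: ~: S) set0.
  have CS : C \subset S.
    by apply/subsetP => x xC; apply: contraT => xS; move/setP/(_ x): d0; rewrite !inE xC xS.
  suff Cm : (#|C| <= m)%N by apply: leq_trans Cm _; rewrite leq_pmull.
  apply: hm connC; have -> : C = C :&: (S :\ v).
    apply/esym/setIidPl; apply/subsetP => x xC; rewrite !inE (subsetP CS) // andbT.
    by have := subsetP sC _ xC; rewrite !inE.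
  exact: closed_in_setI cC sSv.
have sScC : ~: S \subset C.
  have /connectedP/(_ _ (closed_in_setI cC sScv) dn0) <- := cSc.
  exact: subsetIl.
have Scn0 : ~: S != set0.
  by apply: contraNneq dn0 => ->; rewrite setI0.
have evS : (0 < e [set v] (~: S))%N.
  case: hv => [e0|[w wS vw]]; first by rewrite e0 eqxx in Scn0.
  by apply: edges_between_gt0 vw; rewrite ?set11 // inE.
pose K := C :&: (S :\ v).
have cK : closed_in G (S :\ v) K := closed_in_setI cC sSv.
have CE : C = K :|: ~: S.
  apply/setP => x; rewrite !inE; case: (boolP (x \in S)) => xS.
    rewrite orbF andbT; case: (boolP (x \in C)) => //= xC.
    by have := subsetP sC _ xC; rewrite !inE => ->.
  by rewrite orbT; apply: (subsetP sScC); rewrite inE.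
have attached L : closed_in G (S :\ v) L -> L \subset K -> L != set0 ->
    (0 < e L (~: S))%N.
  move=> cL sLK L0; rewrite lt0n; apply/negP => /eqP eL0.
  have [sL hL] := closed_inP _ _ _ cL.
  have cLC : closed_in G C L.
    apply/closed_inP; split.
      by apply: subset_trans sLK _; exact: subsetIl.
    move=> x y xL yC xy; apply: (hL x) => //; rewrite !inE.
    have := subsetP sC _ yC; rewrite !inE => -> /=; apply: contraT => yS.
    by have := edges_between_gt0 xL (_ : y \in ~: S) xy; rewrite inE eL0 => /(_ yS).
  have /connectedP/(_ _ cLC L0) LC := connC.
  case/set0Pn: Scn0 => x xS; have := subsetP sL x; rewrite LC (subsetP sScC) //.
  by rewrite !inE in xS *; rewrite (negPf xS) andbF => /(_ isT).
have [K0|Kn0] := eqVneq K set0.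
  by rewrite CE K0 set0U; apply: leq_trans cm _; rewrite leq_pmull.
have [C' [sC'K cC' C'0 connC']] := exists_connected_closed_in cK Kn0.
have C'm := hm _ cC' connC'.
have [K'0|K'n0] := eqVneq (K :\: C') set0.
  have KE : K = C' by apply/eqP; rewrite eqEsubset sC'K -setD_eq0 K'0 eqxx.
  rewrite CE KE; apply: leq_trans (leq_card_setU _ _) _.
  by rewrite mul2n -addnn leq_add.
have := attached _ cC' sC'K C'0.
have := attached _ (closed_inD cK cC') (subsetDl _ _) K'n0.
have [s1 _] := closed_inP _ _ _ cC'.
have [s2 _] := closed_inP _ _ _ (closed_inD cK cC').
have := edges_between_three vS s1 s2.
have -> : [disjoint C' & K :\: C'].
  by apply/pred0P => x; rewrite /= inE; case: (x \in C').
move=> /(_ isT); clear -evS cut2; lia.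
Qed.

Lemma exists_balanced_closed_in W (m : nat) : (0 < m)%N -> #|W| = m ->
  (forall K, closed_in G W K -> connected G K -> (3 * #|K| <= 2 * m)%N) ->
  exists A, closed_in G W A /\ (m <= 3 * #|A| <= 2 * m)%N.
Proof.
move=> m0 Wm hK; pose P A := closed_in G W A && (3 * #|A| <= 2 * m)%N.
have P0 : P set0 by rewrite /P closed_in0 cards0.
case: (arg_maxnP (fun A : {set V} => #|A|) P0) => A /andP[cA Am] maxA.
have [mA|Am'] := leqP m (3 * #|A|); first by exists A; rewrite mA.
have [sA _] := closed_inP _ _ _ cA.
have Wn0 : W :\: A != set0.
  rewrite setD_eq0; apply/negP => /subset_leq_card; lia.
have [C [sC cC C0 connC]] := exists_connected_closed_in (closed_in_setC cA) Wn0.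
have dAC : [disjoint A & C].
  by rewrite disjoint_sym disjoints_subset; apply/subsetP => x /(subsetP sC);
    rewrite !inE => /andP[].
exists C; split=> //; rewrite hK // andbT leqNgt; apply/negP => Cm.
have cU : #|A :|: C| = (#|A| + #|C|)%N.
  by rewrite cardsU disjoint_setI0 // cards0 subn0.
have : (0 < #|C|)%N by rewrite card_gt0.
have /maxA : P (A :|: C) by rewrite /P closed_inU // cU; lia.
rewrite /= cU; lia.
Qed.

Lemma balanced_cut_or_separator : (1 < n)%N ->
  (exists S, (e S (~: S) <= 2)%N /\ (n <= 3 * #|S| <= 2 * n)%N) \/
  (exists v A, closed_in G (~: [set v]) A /\
     (n.-1 <= 3 * #|A| <= 2 * n.-1)%N).
Proof.
move=> n1; pose P S := [&& connected G S, connected G (~: S) & (n <= 3 * #|S|)%N].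
have conn0 : connected G set0.
  by apply/connectedP => T /closed_inP[]; rewrite subset0 => /eqP.
have PT : P setT by rewrite /P connV setCT conn0 cardsT; lia.
case: (arg_minnP (fun S : {set V} => #|S|) PT) => S /and3P[cS cSc nS] minS.
have cut2 := connected_cut_le2 cS cSc edgesV.
have [S2|S2] := leqP (3 * #|S|) (2 * n); first by left; exists S; rewrite nS.
right.
have [v vS hv] : exists2 v, v \in S &
    (~: S = set0 \/ exists2 w, w \notin S & adj G v w).
  have [Sc0|Scn0] := eqVneq (~: S) set0.
    have /card_gt0P[v vS] : (0 < #|S|)%N by lia.
    by exists v => //; left.
  have S0 : S != set0 by rewrite -card_gt0; lia.
  have ST : S != setT by apply: contraNneq Scn0 => ->; rewrite setCT.
  have [v [w [vS _ wS vw]]] := connected_grow connV (subsetT S) S0 ST.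
  by exists v => //; right; exists w.
have W1 : #|~: [set v]| = n.-1 by have := cardsC [set v]; rewrite cards1; lia.
exists v; apply: exists_balanced_closed_in => // [|C cC connC]; first lia.
suff : (#|C| <= 2 * (n.-1 %/ 3))%N by lia.
apply: (component_size cSc cut2 vS hv _ _ cC connC).
  by have := cardsC S; lia.
move=> K cK connK; rewrite leqNgt; apply/negP => Kn.
have [/subset_leq_card sK _] := closed_inP _ _ _ cK.
have third (p k : nat) : (p.-1 %/ 3 < k)%N -> (p <= 3 * k)%N by clear; lia.
have /minS : P K.
  by rewrite /P connK (connected_setC_component connV cSc vS hv cK) third.
have : (#|S| = #|S :\ v|.+1)%N by rewrite (cardsD1 v S) vS.
by move=> -> ; rewrite leqNgt ltnS sK.
Qed.

End Separators.

Lemma path_bound_nat (p m b : nat) : (6 <= p)%N -> (m = p.-1./2)%N ->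
  (p <= m + b + 2)%N -> (m + b <= p)%N ->
  (8 * p * (m ^ 2 + b ^ 2) <= 27 * (m * b * (m + b)))%N.
Proof.
move=> p6 mE b1 b2.
have [[k [pE mk]]|[k [pE mk]]] : (exists k, p = 2 * k + 7 /\ m = k + 3)%N \/
    (exists k, p = 2 * k + 6 /\ m = k + 2)%N.
- have [po|po] := boolP (odd p); [left; exists (m - 3)%N|right; exists (m - 2)%N]; lia.
- have : (b = k + 2 \/ b = k + 3 \/ b = k + 4)%N by lia.
  by clear -pE mk; case=> [|[]] ->; subst; rewrite !expnS !expn0; nia.
- have : (b = k + 2 \/ b = k + 3 \/ b = k + 4)%N by lia.
  by clear -pE mk; case=> [|[]] ->; subst; rewrite !expnS !expn0; nia.
Qed.

Section EigenvalueRatio.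

Variables (R : realType) (V : finType) (G : sgraph V).
Implicit Types (A B S T Z : {set V}) (v w x y : V).

Local Notation e := (edges_between G).
Local Notation n := #|V|.
Local Notation l2 := (lambda R G 2).
Local Notation ln := (lambda R G #|V|).

Lemma ratio_disconnected : ~~ connected G setT -> l2 / ln <= 0.
Proof.
move=> /forallPn[T]; rewrite negb_imply => /andP[/andP[cT T0] TT].
have T1 : (0 < #|T|)%N by rewrite card_gt0.
have C1 : (0 < #|~: T|)%N.
  by rewrite card_gt0; apply: contra TT => /eqP h; rewrite -(setCK T) h setC0.
have nE := cardsC T; have n1 : (1 < n)%N by lia.
have := lambda2_cut R G T n1; rewrite -setTD closed_in_edges // mulr0 setTD.
rewrite pmulr_lle0 ?mulr_gt0 ?ltr0n // => h.
by apply: mulr_le0_ge0 => //; rewrite invr_ge0 lambdan_ge0 //; lia.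
Qed.

Lemma edges_between_suml A B : e A B = (\sum_(x in A) e [set x] B)%N.
Proof. by apply: eq_bigr => x _; rewrite /edges_between big_set1. Qed.

Lemma degree_split x S : (e [set x] S + e [set x] (~: S))%N = degree G x.
Proof.
have d : [disjoint S & ~: S] by rewrite -setI_eq0 setICr.
by rewrite -edges_betweenUr // setUCr edges_between_set1 // subsetT.
Qed.

Lemma degree_lt_card x : (degree G x < n)%N.
Proof.
rewrite -(cardsC [set x]) cards1 add1n ltnS; apply: subset_leq_card.
apply/subsetP => w; rewrite !inE => xw; apply: contraTneq xw => ->.
by rewrite adj_irr.
Qed.

Lemma exists_small_cut (k : nat) : connected G setT ->
  (forall x, (degree G x <= 2)%N) -> (k < n)%N ->
  exists S, #|S| = k.+1 /\ (e S (~: S) <= 2)%N.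
Proof.
move=> cV deg2; elim: k => [n0|k IHk kn].
  have /card_gt0P[x _] := n0; exists [set x]; rewrite cards1; split=> //.
  by have := degree_split x [set x]; have := deg2 x; lia.
have [S [cS cutS]] := IHk (ltnW kn).
have S0 : S != set0 by rewrite -card_gt0 cS.
have ST : S != setT by apply: contraTneq kn => h; rewrite -cS h cardsT ltnn.
have [x [y [xS _ yS xy]]] := connected_grow cV (subsetT S) S0 ST.
exists (y |: S); split; first by rewrite cardsU1 yS cS.
have d1 : [disjoint [set y] & S] by rewrite disjoints1.
have d2 : [disjoint [set y] & ~: (y |: S)] by rewrite disjoints1 !inE eqxx.
have SE : ~: S = [set y] :|: ~: (y |: S).
  by apply/setP => z; rewrite !inE; case: eqP => // ->; rewrite yS.
have ySx : (0 < e [set y] S)%N.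
  by apply: (edges_between_gt0 (x := y) (y := x)); rewrite ?set11 // adj_sym.
have := degree_split y S; have := deg2 y; move: cutS.
rewrite SE edges_betweenUr // edges_betweenUl // (edges_betweenC G S [set y]).
rewrite edges_betweenUr //; lia.
Qed.

Lemma lambda2_degree2 : connected G setT -> (forall x, (degree G x <= 2)%N) ->
  (6 <= n)%N -> 4 * n%:R * l2 <= 27.
Proof.
move=> cV deg2 n6.
have [A [cA cutA]] : exists A, #|A| = n.-1./2 /\ (e A (~: A) <= 2)%N.
  have -> : n.-1./2 = (n.-1./2).-1.+1 by lia.
  by apply: exists_small_cut => //; lia.
pose Z := [set z in ~: A | [exists x in A, adj G x z]].
pose B := ~: A :\: Z.
have sZ : Z \subset ~: A by apply/subsetP => z; rewrite inE => /andP[].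
have sB : B \subset ~: A by exact: subsetDl.
have zA z : z \in Z -> (0 < e [set z] A)%N.
  rewrite inE => /andP[_ /exists_inP[x xA xz]].
  by apply: (edges_between_gt0 (x := z) (y := x)); rewrite ?set11 // adj_sym.
have eZ : (#|Z| <= e A Z)%N.
  rewrite edges_betweenC edges_between_suml -sum1_card.
  by apply: leq_sum => z /zA.
have eAZ : (e A Z <= 2)%N by exact: leq_trans (edges_betweenSr G A sZ) cutA.
have eBZ : (e B Z <= 2)%N.
  apply: leq_trans (leq_trans eZ eAZ).
  rewrite edges_betweenC edges_between_suml -sum1_card.
  apply: leq_sum => z /zA zA0; have := degree_split z A; have := deg2 z.
  by have := edges_betweenSr G [set z] sB; lia.
have eAB : e A B = 0%N.
  apply: edges_between_eq0 => x y xA; rewrite !inE => /andP[h yA].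
  by apply: contra h => xy; rewrite yA; apply/exists_inP; exists x.
have dAB : [disjoint A & B].
  by rewrite disjoint_sym disjoints_subset.
have ZE : ~: (A :|: B) = Z.
  apply/setP => z; rewrite !inE; case: (z \in A) => //=.
  by rewrite andbT negbK.
have cB : (#|A| + #|B| + #|Z|)%N = n.
  have -> : (#|A| + #|B| = #|A :|: B|)%N by rewrite cardsU disjoint_setI0 // cards0 subn0.
  by rewrite -ZE cardsC.
have n1 : (1 < n)%N by lia.
have := lambda2_two_sets R G n1 dAB; rewrite eAB mulr0 add0r ZE.
have Z2 := leq_trans eZ eAZ.
have key := @path_bound_nat n #|A| #|B| n6 cA.
have {}key : (8 * n * (#|A| ^ 2 + #|B| ^ 2) <= 27 * (#|A| * #|B| * (#|A| + #|B|)))%N.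
  by apply: key; lia.
have ab : (0 < #|A| * #|B| * (#|A| + #|B|))%N by rewrite !muln_gt0; lia.
move: key; rewrite -(ler_nat R) !natrM !natrD !natrX => key.
have [l0 _|l0 h] := lerP l2 0.
  by apply: (@le_trans _ _ 0); rewrite ?mulr_ge0_le0 ?mulr_ge0.
move: ab; rewrite -(ltr0n R) !natrM natrD in h * => ab.
rewrite -(ler_pM2r ab); apply: le_trans key.
have hA : (e A Z)%:R <= 2 :> R by rewrite ler_nat.
have hB : (e B Z)%:R <= 2 :> R by rewrite ler_nat.
have h2 : l2 * (#|A|%:R * #|B|%:R * (#|A|%:R + #|B|%:R)) <=
    2 * (#|A|%:R ^+ 2 + #|B|%:R ^+ 2).
  apply: le_trans h _; rewrite addrC mulrDr !(mulrC 2).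
  by apply: lerD; apply: ler_wpM2l => //; exact: sqr_ge0.
have n0 : 0 <= 4 * n%:R :> R by rewrite mulr_ge0.
rewrite -[leLHS]mulrA; apply: le_trans (ler_wpM2l n0 h2) _.
by rewrite le_eqVlt; apply/orP; left; apply/eqP; ring.
Qed.

Lemma lambda2_balanced_cut S : (1 < n)%N -> (e S (~: S) <= 2)%N ->
  (n <= 3 * #|S| <= 2 * n)%N -> 4 * n%:R * l2 <= 36.
Proof.
move=> n1 cut2 /andP[h1 h2].
have [l0|l0] := lerP l2 0.
  by apply: (@le_trans _ _ 0); rewrite ?mulr_ge0_le0 ?mulr_ge0.
have := lambda2_cut R G S n1.
have nE : #|S|%:R + #|~: S|%:R = n%:R :> R by rewrite -natrD cardsC.
have n0 : 0 < n%:R :> R by rewrite ltr0n; lia.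
move: cut2 h1 h2; rewrite -!(ler_nat R) !natrM.
move: nE l0 n0; move: (n%:R) (#|S|%:R) (#|~: S|%:R) ((e S (~: S))%:R) l2.
move=> p s t c l nE l0 p0 c2 h1 h2 h.
have st : 2 * p ^+ 2 <= 9 * (s * t).
  have tE : t = p - s by lra.
  have : 0 <= (3 * s - p) * (2 * p - 3 * s) by apply: mulr_ge0; lra.
  by rewrite tE; lra.
have : l * (2 * p ^+ 2) <= p * 18.
  apply: le_trans (_ : l * (9 * (s * t)) <= _); first by rewrite ler_pM2l.
  have : p * c <= p * 2 by rewrite ler_pM2l.
  lra.
rewrite (_ : l * _ = p * (2 * p * l)); last by ring.
by rewrite ler_pM2l //; lra.
Qed.

Lemma lambda2_separated_cut S (D : nat) : (1 < n)%N -> (D < n)%N ->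
  (2 * e S (~: S) <= D)%N -> (n.-1 <= 3 * #|S| <= 2 * n.-1)%N ->
  4 * n%:R * l2 <= 9 * D.+1%:R.
Proof.
move=> n1 Dn cutD /andP[h1 h2].
have [l0|l0] := lerP l2 0.
  by apply: (@le_trans _ _ 0); rewrite ?mulr_ge0_le0 ?mulr_ge0.
have := lambda2_cut R G S n1.
have nE : #|S|%:R + #|~: S|%:R = n%:R :> R by rewrite -natrD cardsC.
have nE1 : n%:R = n.-1%:R + 1 :> R by rewrite natr1 prednK //; lia.
have n0 : 1 <= n.-1%:R :> R by rewrite ler1n; lia.
have D0 : 0 <= D%:R :> R by [].
have {}Dn : D%:R <= n.-1%:R :> R by rewrite ler_nat; lia.
rewrite -(natr1 D).
move: cutD h1 h2; rewrite -!(ler_nat R) !natrM.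
move: nE l0 nE1 n0 Dn D0.
move: (n%:R) (n.-1%:R) (#|S|%:R) (#|~: S|%:R) ((e S (~: S))%:R) (D%:R) l2.
move=> p q s t c d l nE l0 pE q1 dq d0 cd h1 h2 h.
have {nE}tE : t = q + 1 - s by lra.
subst p t.
have st : 2 * q ^+ 2 + 3 * q <= 9 * (s * (q + 1 - s)).
  have : 0 <= (3 * s - q) * (2 * q - 3 * s) by apply: mulr_ge0; lra.
  by lra.
have st0 : 0 < 2 * q ^+ 2 + 3 * q by rewrite addr_gt0 ?mulr_gt0 ?exprn_gt0 //; lra.
have h3 : l * (2 * q ^+ 2 + 3 * q) <= 9 * ((q + 1) * c).
  apply: le_trans (_ : l * (9 * (s * (q + 1 - s))) <= _); first by rewrite ler_pM2l.
  lra.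
have h4 : (q + 1) * (2 * c) <= (q + 1) * d by rewrite ler_pM2l //; lra.
rewrite -(ler_pM2r st0).
apply: le_trans (_ : 18 * (q + 1) ^+ 2 * d <= _).
  have : (q + 1) * (l * (2 * q ^+ 2 + 3 * q)) <= (q + 1) * (9 * ((q + 1) * c)).
    by rewrite ler_pM2l //; lra.
  have : (q + 1) * ((q + 1) * (2 * c)) <= (q + 1) * ((q + 1) * d).
    by rewrite ler_pM2l //; lra.
  lra.
have : d * (q + 2) <= q * (q + 2) by rewrite ler_pM2r //; lra.
have : 0 <= q * (q + 1) by apply: mulr_ge0; lra.
lra.
Qed.

Lemma lambda2_max_degree (D : nat) : (1 < n)%N -> connected G setT ->
  e setT setT = (2 * n)%N -> (3 <= D < n)%N -> (forall x, (degree G x <= D)%N) ->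
  4 * n%:R * l2 <= 9 * D.+1%:R.
Proof.
move=> n1 cV eV /andP[D3 Dn] degD.
case: (balanced_cut_or_separator cV eV n1) => [[S [cut2 hS]]|[v [A [cA hA]]]].
  apply: le_trans (lambda2_balanced_cut n1 cut2 hS) _.
  by rewrite -natrM ler_nat; lia.
have [sA _] := closed_inP _ _ _ cA.
pose B := ~: [set v] :\: A.
have eAB : e A B = 0%N by exact: closed_in_edges.
have vA : v \notin A by apply/negP => /(subsetP sA); rewrite !inE eqxx.
have CA : ~: A = [set v] :|: B.
  by apply/setP => x; rewrite !inE; case: eqP => [->|_]; rewrite ?andbT.
have CB : ~: B = [set v] :|: A.
  by apply/setP => x; rewrite !inE; case: eqP => [->|_] /=; rewrite ?andbF ?andbT ?negbK.
have dvA : [disjoint [set v] & A] by rewrite disjoints1.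
have dvB : [disjoint [set v] & B] by rewrite disjoints1 !inE eqxx andbF.
have cutA : e A (~: A) = e [set v] A.
  by rewrite CA edges_betweenUr // eAB addn0 edges_betweenC.
have cutB : e B (~: B) = e [set v] B.
  by rewrite CB edges_betweenUr // (edges_betweenC G B A) eAB addn0 edges_betweenC.
have cutAB : (e [set v] A + e [set v] B <= D)%N.
  apply: leq_trans (degD v); rewrite -(degree_split v A) leq_add2l.
  by rewrite edges_betweenSr // CA subsetUr.
have cAB : (#|A| + #|B|)%N = n.-1.
  have := cardsC A; rewrite CA cardsU disjoint_setI0 // cards0 cards1; lia.
have [hc|hc] := leqP (e [set v] A) (e [set v] B).
  apply: (lambda2_separated_cut (S := A)) => //; rewrite cutA; lia.
apply: (lambda2_separated_cut (S := B)) => //; rewrite ?cutB; lia.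
Qed.

Lemma ratio_average_degree2 : (6 <= n)%N -> average_degree G = 2 ->
  l2 / ln <= 9 / (4 * n%:R).
Proof.
move=> n6 avg.
have n0 : 0 < n%:R :> R by rewrite ltr0n; lia.
have [cV|/ratio_disconnected] := boolP (connected G setT); last first.
  by move/le_trans; apply; rewrite divr_ge0 // mulr_ge0 // ltW.
have eV : e setT setT = (2 * n)%N.
  apply/eqP; rewrite -(eqr_nat rat) -card_edges (natrM _ 2 n) -[2%:R]avg.
  by rewrite /average_degree divfK // pnatr_eq0; lia.
have [v0 _] : exists v0 : V, true by have /card_gt0P[v0 _] : (0 < n)%N by lia.
case: (arg_maxnP (degree G) (isT : xpredT v0)) => v _ maxv.
have degv x : (degree G x <= degree G v)%N by exact: maxv.
have dv2 : (2 <= degree G v)%N.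
  rewrite -(leq_pmul2r (_ : 0 < n)%N); last lia.
  rewrite -eV -sum_degree mulnC -sum_nat_const; exact: leq_sum.
have dv0 : (0 < degree G v)%N by lia.
have hln := degree_lt_lambdan R dv0.
have ln0 : 0 < ln by apply: lt_le_trans hln; rewrite ltr0n.
suff h : 4 * n%:R * l2 <= 9 * (degree G v).+1%:R.
  rewrite ler_pdivrMr // mulrAC ler_pdivlMr ?mulr_gt0 // mulrC.
  by apply: le_trans h _; rewrite ler_pM2l.
have [d3|d2] := leqP 3 (degree G v).
  by apply: lambda2_max_degree => //; rewrite ?d3 ?degree_lt_card //; lia.
have -> : degree G v = 2%N by lia.
rewrite -(natrM _ 9 3); apply: lambda2_degree2 => // x.
by apply: leq_trans (degv x) _; lia.
Qed.

Lemma connected_card (d : rat) : connected G setT -> average_degree G = d ->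
  (2 - d) * n%:R <= 2.
Proof.
move=> /connected_edges; rewrite -card_edges cardsT => h <-.
have [n0|n0] := posnP n; first by rewrite n0 mulr0.
rewrite mulrBl /average_degree divfK ?pnatr_eq0 -?lt0n //.
by rewrite lerBlDr -natrM -natrD ler_nat; lia.
Qed.

End EigenvalueRatio.

Theorem theorem1p3 (R : realType) :
  (forall d : rat, 1 <= d <= 2 ->
     forall eps : R, 0 < eps ->
       exists n0 : nat, forall (V : finType) (G : sgraph V),
         average_degree G = d -> (n0 <= #|V|)%N ->
         lambda R G 2 / lambda R G #|V| <=
           (ratr d - 2 * Num.sqrt (ratr d - 1)) /
           (ratr d + 2 * Num.sqrt (ratr d - 1)) + eps)
  /\
  (forall (V : finType) (G : sgraph V),
     (6 <= #|V|)%N -> average_degree G = 2 ->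
     lambda R G 2 / lambda R G #|V| <= 9 / (4 * #|V|%:R)).
Proof.
split; last exact: ratio_average_degree2.
move=> d /andP[d1 d2] eps eps0.
have [->|dn2] := eqVneq d 2.
  rewrite (_ : (ratr 2 - _) / _ = 0) ?add0r; last first.
    have -> : ratr 2 = 2 :> R by rewrite ratr_nat.
    have -> : 2 - 1 = 1 :> R by lra.
    by rewrite sqrtr1 mulr1 subrr mul0r.
  exists (maxn 6 (Num.bound (9 / (4 * eps)))) => V G avg.
  rewrite geq_max => /andP[n6 nb].
  apply: le_trans (ratio_average_degree2 R n6 avg) _.
  have n0 : 0 < #|V|%:R :> R by rewrite ltr0n; lia.
  rewrite ler_pdivrMr ?mulr_gt0 // mulrA (mulrC eps) -ler_pdivrMl ?mulr_gt0 //.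
  rewrite [leLHS]mulrC; apply: le_trans (_ : (Num.bound (9 / (4 * eps)))%:R <= _).
    by apply/ltW/archi_boundP; rewrite divr_ge0 // mulr_ge0 // ltW.
  by rewrite ler_nat.
have dlt2 : 0 < 2 - d by rewrite subr_gt0 lt_neqAle dn2.
exists (Num.bound (2 / (2 - d))) => V G avg nb.
apply: le_trans (ratio_disconnected R _) _.
  apply/negP => /connected_card/(_ avg).
  rewrite mulrC -ler_pdivlMr // leNgt; case/negP.
  apply: lt_le_trans (_ : (Num.bound (2 / (2 - d)))%:R <= _); last by rewrite ler_nat.
  by apply: archi_boundP; rewrite divr_ge0 // ltW.
have dr : 0 <= ratr d - 1 :> R by rewrite subr_ge0 -[1]/(1%:R) -(ratr_nat R 1) ler_rat.
set s := Num.sqrt _.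
have s0 : 0 <= s by exact: sqrtr_ge0.
have s2 : ratr d = s ^+ 2 + 1 by rewrite sqr_sqrtr // subrK.
apply: addr_ge0 (ltW eps0); apply: divr_ge0.
  have -> : ratr d - 2 * s = (s - 1) ^+ 2 by rewrite s2; ring.
  exact: sqr_ge0.
by rewrite s2 addr_ge0 ?addr_ge0 ?mulr_ge0 ?sqr_ge0.
Qed.
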